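(* Let $G$ be a word-representable split graph. Then $\mathcal{R}(G)\le 3$.
   Context: A split graph is a graph whose vertex set can be partitioned into a clique and an independent set. A word over a finite set $X$ is a finite sequence of elements of $X$; two letters $x,y$ alternate in a word $u$ if the subsequence of $u$ consisting of all occurrences of $x$ and $y$ is of the form $xyxy\cdots$ or $yxyx\cdots$ (even or odd length). A graph $G=(V,E)$ is word-representable if there is a word $w$ over $V$ (each vertex occurring) such that for all distinct $a,b\in V$, $ab\in E$ if and only if $a$ and $b$ alternate in $w$; $w$ is then said to represent $G$. A word is $k$-uniform if every letter occurs exactly $k$ times. The representation number $\mathcal{R}(G)$ of a word-representable graph $G$ is the smallest $k$ such that some $k$-uniform word represents $G$. *)

(* Defs.v *)
From mathcomp Require Import all_boot.
Set Implicit Arguments. Unset Strict Implicit. Unset Printing Implicit Defensive.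

Definition simple_graph (T : finType) (E : rel T) : Prop :=
  symmetric E /\ irreflexive E.

Definition split_graph (T : finType) (E : rel T) : Prop :=
  exists C I : {set T},
    [/\ C :&: I = set0, C :|: I = setT,
        (forall a b, a \in C -> b \in C -> a != b -> E a b) &
        (forall a b, a \in I -> b \in I -> ~~ E a b)].

(* x and y alternate in w: the subsequence of w formed by all occurrences
   of x and y has no two equal consecutive letters (xyxy... or yxyx...). *)
Definition alternate (T : eqType) (w : seq T) (x y : T) : bool :=
  sorted (fun a b => a != b) [seq z <- w | (z == x) || (z == y)].

Definition represents (T : finType) (E : rel T) (w : seq T) : Prop :=
  (forall v : T, v \in w) /\
  (forall a b : T, a != b -> (E a b <-> alternate w a b)).

Definition word_representable (T : finType) (E : rel T) : Prop :=
  exists w : seq T, represents E w.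

Definition uniform (T : finType) (k : nat) (w : seq T) : Prop :=
  forall v : T, count_mem v w = k.

(* Some k-uniform word represents G. The representation number R(G) is the
   least such k, so R(G) <= m iff exists k <= m with k_representable. *)
Definition k_representable (T : finType) (E : rel T) (k : nat) : Prop :=
  exists w : seq T, uniform k w /\ represents E w.

(* Main.v *)
(* In a word w representing the graph, the clique letters occur in a fixed cyclic
   order 1, ..., m.  With d = (clique letters read so far) - m * (occurrences of
   a read so far), an outer vertex a alternates with the clique letter i iff d
   stays in [i - m, i + m) or in [i - 2m, i) on every prefix.  So the range of d
   encodes a closed arc of gaps of the cyclic order, the neighbours of a being
   the clique letters outside the arc, and the arcs of two outer vertices meet
   because otherwise these would alternate.

   Conversely, cut the cycle at a gap: the "linear" arcs, avoiding the cut, are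
   pairwise intersecting intervals [lo, hi], hence share a gap g; the other arcs
   all contain the cut.  Three copies of 1...m are filled as follows: a linear
   arc puts its letter at hi, g, lo; an arc through the cut with neighbourhood
   (lo, hi] puts it at the very start, at hi in the first copy and at lo in the
   third one.  Reversing the order of the letters placed at the start and at g
   destroys all alternations between letters of the same type. *)
Require Import Defs.
From mathcomp Require Import all_boot.
From mathcomp Require Import zify.
Set Implicit Arguments. Unset Strict Implicit. Unset Printing Implicit Defensive.

(** * Alternation in terms of prefix counts *)

Definition leads (T : eqType) (w : seq T) (x y : T) : Prop :=
  forall n, count_mem y (take n w) <= count_mem x (take n w)
            <= (count_mem y (take n w)).+1.

Lemma leads_cons (T : eqType) (w : seq T) (x y z : T) :
  z != x -> z != y -> leads (z :: w) x y <-> leads w x y.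
Proof.
move=> /negPf zx /negPf zy; split=> h n.
  by have := h n.+1; rewrite /= zx zy.
by case: n => [|n] //=; rewrite zx zy; apply: h.
Qed.

Lemma leads_cons_head (T : eqType) (w : seq T) (x y : T) :
  x != y -> leads (x :: w) x y <-> leads w y x.
Proof.
move=> /negPf xy; split=> h n.
  by have := h n.+1; rewrite /= eqxx xy; lia.
by case: n => [|n] //=; rewrite eqxx xy; have := h n; lia.
Qed.

Lemma leads_cons_absurd (T : eqType) (w : seq T) (x y : T) :
  x != y -> ~ leads (y :: w) x y.
Proof.
by rewrite eq_sym => /negPf xy /(_ 1); rewrite /= take0 /= eqxx xy.
Qed.

(** Once [x] has been read, the next of the two letters must be [y], so [y] leads the rest. *)
Lemma path_leads (T : eqType) (w : seq T) (x y : T) : x != y ->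
  path (fun a b => a != b) x [seq z <- w | (z == x) || (z == y)]
  <-> leads w y x.
Proof.
elim: w x y => [|z w IH] x y xy //=.
have yx : y != x by rewrite eq_sym.
have [->|zx] := eqVneq z x.
  by rewrite /= eqxx; split=> // /(leads_cons_absurd yx).
have [->|zy] /= := eqVneq z y.
  rewrite xy leads_cons_head //= -(IH _ _ yx).
  by under eq_filter do rewrite orbC.
by rewrite leads_cons // IH.
Qed.

Lemma alternate_sym (T : eqType) (w : seq T) (x y : T) :
  alternate w x y = alternate w y x.
Proof. by rewrite /alternate; under eq_filter do rewrite orbC. Qed.

Lemma alternateP (T : eqType) (w : seq T) (x y : T) : x != y ->
  alternate w x y <-> leads w x y \/ leads w y x.
Proof.
rewrite /alternate; elim: w => [|z w IH] xy /=; first by split; [left|].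
have yx : y != x by rewrite eq_sym.
have [->|zx] := eqVneq z x.
  rewrite /= path_leads // leads_cons_head //.
  by split=> [|[//|/(leads_cons_absurd yx)//]]; left.
have [->|zy] /= := eqVneq z y.
  under eq_filter do rewrite orbC.
  rewrite path_leads // leads_cons_head //.
  by split=> [|[/(leads_cons_absurd xy)//|//]]; right.
by rewrite !leads_cons // IH.
Qed.

(** The prefix ending at the first [x] must already contain a [y]. *)
Lemma leads_index (T : eqType) (w : seq T) (x y : T) :
  x \in w -> leads w y x -> index y w <= index x w.
Proof.
move=> xw /(_ (index x w).+1) /andP[h _].
have : x \in take (index x w).+1 w by rewrite in_take_leq ?index_mem.
rewrite -has_pred1 has_count => /leq_trans/(_ h).
by rewrite -has_count has_pred1 in_take_leq ?index_mem.
Qed.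

Lemma attained_bounds (f : nat -> nat) (N : nat) :
  (forall n, f n = f (minn n N)) ->
  exists a b, forall n, f a <= f n <= f b.
Proof.
move=> fN.
case: (@arg_minnP 'I_N.+1 ord0 predT f isT) => a _ ha.
case: (@arg_maxnP 'I_N.+1 ord0 predT f isT) => b _ hb.
exists a, b => n; rewrite [f n]fN.
have hn : minn n N < N.+1 by rewrite ltnS geq_minr.
by apply/andP; split; [apply: (ha (Ordinal hn)) | apply: (hb (Ordinal hn))].
Qed.

(** * The cyclic order of the clique and the range of the offset *)

Section Arcs.
Variables (T : finType) (w : seq T) (C : {set T}).
Hypothesis wT : forall v, v \in w.
Hypothesis clq : {in C &, forall x y, x != y -> alternate w x y}.

Definition prefix_count x n := count_mem x (take n w).
Definition prefix_total n := \sum_(y in C) prefix_count y n.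
Definition clique_pos x := #|[set y in C | index y w <= index x w]|.

Local Notation c := prefix_count.
Local Notation s := prefix_total.
Local Notation m := #|C|.
Local Notation pos := clique_pos.

Lemma clique_pos_inj : {in C &, injective pos}.
Proof.
move=> x y xC yC; apply: contra_eq => xy.
have sub u v : v \in C -> index u w < index v w -> pos u < pos v.
  move=> vC uv; apply/proper_card/properP; split.
    by apply/subsetP => z; rewrite !inE => /andP[-> /=]; lia.
  by exists v; rewrite !inE vC ?leqnn //= -ltnNge.
have : index x w != index y w by apply: contra_neq xy => /(index_inj x (wT x) (wT y)).
by rewrite !neq_ltn => /orP[/(sub _ _ yC)|/(sub _ _ xC)] ->; rewrite ?orbT.
Qed.

Lemma clique_leads x y : x \in C -> y \in C -> x != y ->
  index x w <= index y w -> leads w x y.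
Proof.
move=> xC yC xy le_xy; have yx : y != x by rewrite eq_sym.
case/(alternateP _ xy): (clq xC yC xy) => // /(leads_index (wT x)) le_yx.
by case/eqP: xy; apply: (index_inj x (wT x) (wT y)); apply/eqP; rewrite eqn_leq le_xy.
Qed.

(** Against [x], each clique letter is ahead by 0 or 1 if it first occurs earlier, and behind by 0
    or 1 otherwise; these bounds are summed over the clique. *)
Lemma clique_count x n : x \in C ->
  m * c x n + pos x <= s n + m /\ s n < m * c x n + pos x.
Proof.
move=> xC.
have posE : pos x = \sum_(y in C) (index y w <= index x w).
  by rewrite /clique_pos -sum1dep_card big_mkcondr; apply: eq_bigr => y _; case: ifP.
have mE k : m * k = \sum_(y in C) k by rewrite sum_nat_const.
have bnd y : y \in C -> y != x ->
    c x n + (index y w <= index x w) <= c y n + 1 /\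
    c y n <= c x n + (index y w <= index x w).
  move=> yC yx; case: (leqP (index y w)) => le_yx.
    by move: (clique_leads yC xC yx le_yx n); rewrite -!/(c _ _) /=; lia.
  have xy : x != y by rewrite eq_sym.
  by move: (clique_leads xC yC xy (ltnW le_yx) n); rewrite -!/(c _ _) /=; lia.
rewrite -{2}[m]muln1 !mE posE -!big_split; split.
  apply: leq_sum => y yC; have [->|yx] := eqVneq y x.
    by rewrite leqnn.
  by case: (bnd y yC yx).
(* The summand of [x] itself makes the inequality strict. *)
rewrite /prefix_total (bigD1 x) //= [X in _ < X](bigD1 x) //= leqnn addn1 addSn ltnS.
by rewrite leq_add2l leq_sum // => y /andP[yC yx]; case: (bnd y yC yx).
Qed.

(* The quantity d of the header, shifted by #|C| * size w to remain natural. *)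
Definition offset a n :=
  prefix_total n + #|C| * (size w - prefix_count a n).

Local Notation M := (m * size w).
Local Notation e := offset.

Lemma offsetE a n : e a n + m * c a n = s n + M.
Proof.
have cN : c a n <= size w.
  apply: leq_trans (count_size _ _) _.
  by rewrite size_take_min geq_minr.
by rewrite /offset -addnA -mulnDr subnK.
Qed.

(** By [clique_count], [m * c x n] lies in a window of length [m] fixed by [s n], so comparing
    counts amounts to a threshold on the offset. *)
Lemma clique_le_count x a n k : x \in C ->
  (c x n <= c a n + k) = (e a n < pos x + M + m * k).
Proof.
move=> xC; have [h1 h2] := clique_count n xC; have h3 := offsetE a n.
by apply/idP/idP; nia.
Qed.

Lemma count_le_clique x a n k : x \in C ->
  (c a n <= c x n + k) = (pos x + M <= e a n + m + m * k).
Proof.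
move=> xC; have [h1 h2] := clique_count n xC; have h3 := offsetE a n.
by apply/idP/idP; nia.
Qed.

Lemma count_le_count a b n k :
  e b n < e a n + m * k.+1 -> c a n <= c b n + k.
Proof. by have := offsetE a n; have := offsetE b n; nia. Qed.

(** The thresholds hold on every prefix iff they hold at the extreme offsets; necessity needs [L]
    and [H] to be attained. *)
Lemma leads_clique_bounds x a L H : x \in C ->
    (exists i j, L = e a i /\ H = e a j /\ forall n, L <= e a n <= H) ->
  (leads w x a <-> pos x + M <= L + m /\ H < pos x + M + m) /\
  (leads w a x <-> pos x + M <= L + m + m /\ H < pos x + M).
Proof.
move=> xC [i [j [Li [Hj b]]]].
have k0 n := count_le_clique a n 0 xC; have k1 n := count_le_clique a n 1 xC.
have l0 n := clique_le_count a n 0 xC; have l1 n := clique_le_count a n 1 xC.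
rewrite /leads; split; split=> h.
- move: (h i) (h j); rewrite -!/(c _ _).
  move: (k0 i) (l1 j); lia.
- move=> n; move: (b n) (k0 n) (l1 n); rewrite -!/(c _ _); lia.
- move: (h i) (h j); rewrite -!/(c _ _).
  move: (k1 i) (l0 j); lia.
- move=> n; move: (b n) (k1 n) (l0 n); rewrite -!/(c _ _); lia.
Qed.

(** Reading [a] raises its own count but no clique count. Hence the range of the offset has length
    at least [m]. *)
Lemma offset_drop a : a \notin C ->
  offset a (index a w) = offset a (index a w).+1 + m.
Proof.
move=> aC; set n := index a w.
have cS y : c y n.+1 = c y n + (a == y).
  by rewrite /c (take_nth a) ?index_mem // nth_index // -cats1 count_cat /= addn0.
have sS : s n.+1 = s n.
  apply: eq_bigr => y yC; rewrite cS (_ : a == y = false) ?addn0 //.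
  by apply: contraNF aC => /eqP->.
have := offsetE a n; have := offsetE a n.+1; rewrite sS cS eqxx /=; nia.
Qed.

Lemma arc_bounds : exists L H : T -> nat, forall a,
  (exists i j, L a = e a i /\ H a = e a j /\ forall n, L a <= e a n <= H a) /\
  L a <= M <= H a /\ (a \notin C -> L a + m <= H a).
Proof.
have bnd a : exists LH : nat * nat,
   exists i j, LH.1 = e a i /\ LH.2 = e a j /\ forall n, LH.1 <= e a n <= LH.2.
  case: (@attained_bounds (e a) (size w)) => [n|i [j h]].
    have tk : take n w = take (minn n (size w)) w by rewrite take_min take_size.
    by rewrite /offset /prefix_total /prefix_count tk.
  by exists (e a i, e a j), i, j.
case: (fin_all_exists bnd) => LH hLH.
exists (fun a => (LH a).1), (fun a => (LH a).2) => a.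
have [i [j [_ [_ h]]]] := hLH a; split; first exact: hLH.
split=> [|aC].
  (* The empty prefix has offset [M]. *)
  suff <- : e a 0 = M by apply: h.
  by rewrite /offset /prefix_total /prefix_count take0 /= subn0 big1 ?add0n.
have := h (index a w); have := h (index a w).+1; have := offset_drop aC; lia.
Qed.

Lemma clique_pos_le x : clique_pos x <= m.
Proof. by apply/subset_leq_card/subsetP => y; rewrite inE => /andP[]. Qed.

End Arcs.

(** * From a representing word to arcs *)

(** The last two clauses say that arcs meet: two linear ones, or a linear one and the complement of
    the open range between [lo b] and [hi b]. *)
Lemma split_arcs (T : finType) (E : rel T) (C : {set T}) (w : seq T) :
    {in C &, forall x y, x != y -> E x y} ->
    {in ~: C &, forall a b, ~~ E a b} -> represents E w ->
  exists (pos lo hi : T -> nat) (lin : pred T),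
  [/\ {in C &, injective pos},
      {in C & ~: C, forall x a, E x a = if lin a
         then (pos x <= lo a) || (hi a < pos x) else lo a < pos x <= hi a},
      {in ~: C &, forall a b, lin a -> lin b -> lo a <= hi b} &
      {in ~: C &, forall a b, lin a -> ~~ lin b ->
         (lo a <= lo b) || (hi b <= hi a)}].
Proof.
move=> clqE indE [wT wE].
have clq : {in C &, forall x y, x != y -> alternate w x y}.
  by move=> x y xC yC xy; apply/(wE _ _ xy)/clqE.
have ind a b : a \in ~: C -> b \in ~: C -> a != b -> ~ leads w a b.
  by move=> aC bC ab h; case/negP: (indE a b aC bC); apply/(wE _ _ ab)/alternateP; [|left].
have [L [H LH]] := arc_bounds C wT.
set m := #|C|; set M := m * size w.
(* Otherwise every prefix has as many [b] as [a] or one more, so [a] and [b] would alternate. *)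
have sep a b : a \in ~: C -> b \in ~: C -> a != b ->
    H b < L a + m -> L b + m + m <= H a.
  move=> aC bC ab h1; rewrite leqNgt; apply/negP => h2.
  have ba : b != a by rewrite eq_sym.
  apply: (ind b a bC aC ba) => n.
  have [[_ [_ [_ [_ /(_ n) ha]]]] _] := LH a.
  have [[_ [_ [_ [_ /(_ n) hb]]]] _] := LH b.
  have := @count_le_count _ w C a b n 0; rewrite addn0.
  rewrite -!/(prefix_count w _ n) => -> /=; last by rewrite -/m; lia.
  by rewrite -addn1; apply: (@count_le_count _ w C); rewrite -/m; lia.
(* The arc of a runs from L a + m - M to H a - M; when it leaves [0, m) it passes
   through the cut, and lo, hi then delimit its complement modulo m. *)
pose lin a := (M <= L a + m) && (H a < M + m).
pose lo a := if lin a then L a + m - M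
  else if L a + m < M then H a - M else H a - M - m.
pose hi a := if lin a then H a - M
  else if L a + m < M then L a + m + m - M else L a + m - M.
exists (clique_pos w C), lo, hi, lin; split.
- exact: clique_pos_inj.
- move=> x a xC aC; have xa : x != a.
    by apply: contraTneq xC => ->; rewrite -in_setC.
  have [bnd [hM _]] := LH a.
  have [h1 h2] := leads_clique_bounds wT clq xC bnd.
  have hp := clique_pos_le w C x.
  have -> : E x a = (clique_pos w C x + M <= L a + m) && (H a < clique_pos w C x + M + m)
     || (clique_pos w C x + M <= L a + m + m) && (H a < clique_pos w C x + M).
    apply/idP/idP => [/(wE _ _ xa)/(alternateP _ xa)[/h1|/h2] [-> ->] //|].
      by rewrite orbT.
    by move=> h; apply/(wE _ _ xa)/(alternateP _ xa); case/orP: h => /andP h; [left; apply/h1|right; apply/h2].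
  rewrite /lo /hi; move: hp hM; rewrite -/m -/M.
  by case la: (lin a); last case: ifP => lb; move: la; rewrite /lin; lia.
- move=> a b aC bC la lb; rewrite /lo /hi la lb.
  have [->|ab] := eqVneq a b.
    have [_ [_ /(_ _)h]] := LH b; move: h; rewrite -in_setC => /(_ bC); lia.
  (* If [H b < L a + m], then [sep] and [lin b] give [H a >= L b + 2m >= M + m], against [lin a]. *)
  move: la lb (sep a b aC bC ab); rewrite /lin; lia.
- move=> a b aC bC la lb; rewrite /lo /hi la (negPf lb).
  have ab : a != b by apply: contraTneq la => ->.
  have ba : b != a by rewrite eq_sym.
  (* [sep a b] settles the case [L b + m < M], and [sep b a] the other one. *)
  move: la lb (sep a b aC bC ab) (sep b a bC aC ba) (LH a).2.1 (LH b).2.1.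
  rewrite /lin -/m -/M; case: ifP; lia.
Qed.

(** * The 3-uniform word built from arcs *)

Definition sort_by (T : finType) (key : T -> nat) : seq T :=
  sort (fun x y => key x <= key y) (enum T).

Lemma sort_by_pair (T : finType) (key : T -> nat) (x y : T) : x != y ->
  exists u v, [/\ [seq z <- sort_by key | (z == x) || (z == y)] = [:: u; v],
    key u <= key v & (u, v) \in [:: (x, y); (y, x)]].
Proof.
move=> xy; set t := filter _ _.
have tS : sorted (fun x y => key x <= key y) t.
  apply: sorted_filter => [? ? ?|]; first exact: leq_trans.
  by apply: sort_sorted => ? ?; apply: leq_total.
have : perm_eq t [:: x; y].
  apply: uniq_perm; rewrite /= ?inE ?xy //.
    by rewrite filter_uniq // sort_uniq enum_uniq.
  by move=> z; rewrite mem_filter mem_sort mem_enum !inE andbT.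
move: t tS => t tS; move/[dup]=> /perm_uniq + /[dup] => + /perm_size + /perm_mem tm.
case: t tS tm => [|u [|v []]] //= /andP[uv _] tm; rewrite !inE xy /= andbT.
move=> nuv _; exists u, v; split=> //.
have := tm u; have := tm v; rewrite !inE !eqxx ?orbT /= => /esym/orP[]/eqP ev /esym/orP[]/eqP eu.
all: by move: nuv; rewrite ev eu ?eqxx ?orbT.
Qed.

Lemma sort_by_pair_lt (T : finType) (key : T -> nat) (x y : T) :
  key x < key y ->
  [seq z <- sort_by key | (z == x) || (z == y)] = [:: x; y].
Proof.
move=> kxy; have xy : x != y by apply: contraTneq kxy => ->; rewrite ltnn.
have [u [v [-> + uv]]] := sort_by_pair key xy.
by move: uv; rewrite !inE => /orP[]/eqP[-> ->] //; rewrite leqNgt kxy.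
Qed.

Section Word.
Variables (T : finType) (C : {set T}) (pos lo hi : T -> nat) (lin : pred T).
Variable g : nat.

(* The summands 1 and 2 break ties inside a gap: a letter through the cut comes
   before a linear one in the first copy, and after it in the last copy. *)
Definition fst_key x := if x \in C then 3 * pos x else 3 * hi x + 1 + lin x.
Definition last_key x := if x \in C then 3 * pos x else 3 * lo x + 1 + ~~ lin x.

(** Keeping [t] and [t'] as arguments lets [weave] commute with filtering, so each alternation is
    decided on two-letter copies. *)
Definition weave (t t' : seq T) : seq T :=
  rev [seq x <- t | (x \notin C) && ~~ lin x] ++ t
  ++ ([seq x <- t | (x \in C) && (pos x <= g)]
      ++ rev [seq x <- t | (x \notin C) && lin x]
      ++ [seq x <- t | (x \in C) && (g < pos x)]) ++ t'.

Definition split_word := weave (sort_by fst_key) (sort_by last_key).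

Lemma filter_weave (p : pred T) t t' :
  filter p (weave t t') = weave (filter p t) (filter p t').
Proof.
have sw q (s : seq T) : filter p (filter q s) = filter q (filter p s).
  by rewrite -!filter_predI; apply: eq_filter => x; rewrite /= andbC.
by rewrite /weave !filter_cat !filter_rev !sw.
Qed.

Lemma alternate_split_word x y : alternate split_word x y =
  sorted (fun a b => a != b)
    (weave [seq z <- sort_by fst_key | (z == x) || (z == y)]
           [seq z <- sort_by last_key | (z == x) || (z == y)]).
Proof. by rewrite /alternate filter_weave. Qed.

Lemma uniform_split_word : uniform 3 split_word.
Proof.
move=> v.
have cs key : filter (pred1 v) (sort_by key) = [:: v].
  apply: perm_small_eq => //.
  apply: uniq_perm => //; first by rewrite filter_uniq // sort_uniq enum_uniq.
  by move=> z; rewrite mem_filter mem_sort mem_enum !inE andbT.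
rewrite -size_filter filter_weave !cs /weave /=.
by case: (v \in C); case: (lin v); case: (leqP (pos v) g).
Qed.

Lemma alternate_clique x y : x \in C -> y \in C -> pos x < pos y ->
  alternate split_word x y.
Proof.
move=> xC yC xy; have nxy : x != y by apply: contraTneq xy => ->; rewrite ltnn.
have nyx : y != x by rewrite eq_sym.
rewrite alternate_split_word !sort_by_pair_lt /fst_key /last_key ?xC ?yC; try lia.
rewrite /weave /= xC yC /=.
case: (leqP (pos x)) => xg; case: (leqP (pos y)) => yg /=; rewrite ?nxy ?nyx //; lia.
Qed.

(** For a linear [a], the order of [x] and [a] must be the same in all three copies, where it is
    decided by comparing [pos x] with [hi a], [g] and [lo a]. Otherwise the word starts with [a],
    and only [a xa x ax] alternates. *)
Lemma alternate_cross x a : x \in C -> a \notin C -> (lin a -> lo a <= g <= hi a) ->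
  alternate split_word x a = if lin a
    then (pos x <= lo a) || (hi a < pos x) else lo a < pos x <= hi a.
Proof.
move=> xC aC ga; have nxa : x != a by apply: contraTneq xC => ->.
have nax : a != x by rewrite eq_sym.
have pairE key : key x != key a -> [seq z <- sort_by key | (z == x) || (z == a)] =
    if key x < key a then [:: x; a] else [:: a; x].
  case: ltngtP => // k _; first exact: sort_by_pair_lt.
  by under eq_filter do rewrite orbC; apply: sort_by_pair_lt.
rewrite alternate_split_word !pairE /fst_key /last_key xC (negPf aC);
  try by case: (lin a) => /=; lia.
have -> : (3 * pos x < 3 * hi a + 1 + lin a) = (pos x <= hi a).
  by case: (lin a) => /=; lia.
have -> : (3 * pos x < 3 * lo a + 1 + ~~ lin a) = (pos x <= lo a).
  by case: (lin a) => /=; lia.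
have wE (u v : seq T) : u \in [:: [:: x; a]; [:: a; x]] ->
    v \in [:: [:: x; a]; [:: a; x]] -> weave u v =
    if lin a then u ++ (if pos x <= g then [:: x; a] else [:: a; x]) ++ v
    else a :: u ++ x :: v.
  by rewrite !inE => /orP[]/eqP-> /orP[]/eqP->;
    rewrite /weave /= xC (negPf aC); case: (lin a); case: (leqP (pos x) g).
rewrite wE ?inE; try by case: ifP; rewrite eqxx ?orbT.
case: (lin a) ga => [/(_ isT)|_].
  case: (leqP (pos x) (lo a)) => xl; case: (leqP (pos x) (hi a)) => xh;
    case: (leqP (pos x) g) => xg /=; rewrite ?nxa ?nax ?eqxx //=; lia.
by case: (leqP (pos x) (lo a)) => xl; case: (leqP (pos x) (hi a)) => xh;
  rewrite /= ?nxa ?nax ?eqxx.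
Qed.

(** The restriction is [b], a pair, [a], a pair. It alternates only as [b ab a ba], and the
    tie-breaking keys then force [hi a < hi b] and [lo b < lo a]. *)
Lemma non_alternate_mixed a b : a \notin C -> b \notin C ->
  lin a -> ~~ lin b -> (lo a <= lo b) || (hi b <= hi a) ->
  ~~ alternate split_word a b.
Proof.
move=> aC bC la lb ab; have nab : a != b by apply: contraNneq lb => <-.
have [u [v [e1 k1 uv]]] := sort_by_pair fst_key nab.
have [u' [v' [e3 k3 uv']]] := sort_by_pair last_key nab.
rewrite alternate_split_word e1 e3; move: uv uv' k1 k3; rewrite !inE.
rewrite /fst_key /last_key.
move=> /orP[]/eqP[-> ->] /orP[]/eqP[-> ->];
rewrite /weave /= !(negPf aC) !(negPf bC) la (negPf lb) /= ?eqxx ?andbF //.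
lia.
Qed.

(** A pair next to its reversal repeats a letter at the junction. *)
Lemma non_alternate_same a b : a \notin C -> b \notin C -> a != b ->
  lin a = lin b -> ~~ alternate split_word a b.
Proof.
move=> aC bC nab lab.
have [u [v [e1 _ uv]]] := sort_by_pair fst_key nab.
have [u' [v' [e3 _ uv']]] := sort_by_pair last_key nab.
rewrite alternate_split_word e1 e3; move: uv uv'; rewrite !inE.
by move=> /orP[]/eqP[-> ->] /orP[]/eqP[-> ->];
rewrite /weave /= !(negPf aC) !(negPf bC) lab; case: (lin b); rewrite /= ?eqxx ?andbF.
Qed.

End Word.

Theorem theorem5 (T : finType) (E : rel T) :
  simple_graph E -> split_graph E -> word_representable E ->
  exists2 k : nat, k <= 3 & k_representable E k.
Proof.
move=> [Esym Eirr] [C [I [CI0 CIT clqE indE]]] [w wE].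
have outI a : a \in ~: C -> a \in I.
  by rewrite in_setC => /negPf aC; have := in_setT a; rewrite -CIT inE aC.
have indC : {in ~: C &, forall a b, ~~ E a b}.
  by move=> a b /outI aI /outI bI; apply: indE.
have [//|pos [lo [hi [lin [posI crossE linE mixE]]]]] := split_arcs _ indC wE.
(* Helly's property on a line: the largest left end lies in all the intervals. Without linear arcs
   [g] is 0, and nothing is required of it. *)
pose g := \max_(a in ~: C | lin a) lo a.
have gP a : a \notin C -> lin a -> lo a <= g <= hi a.
  rewrite -in_setC => aC la; apply/andP; split.
    by rewrite /g (bigD1 a) ?aC //= leq_maxl.
  by apply/bigmax_leqP => b /andP[bC lb]; apply: linE.
exists 3 => //; exists (split_word C pos lo hi lin g).
have unif := uniform_split_word C pos lo hi lin g.
split=> //; split=> [v|a b ab]; first by rewrite -has_pred1 has_count unif.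
suff -> : E a b = alternate (split_word C pos lo hi lin g) a b by [].
have ba : b != a by rewrite eq_sym.
have [aC|aC] := boolP (a \in C); have [bC|bC] := boolP (b \in C).
- rewrite clqE //; apply/esym.
  have : pos a != pos b by apply: contra_neq ab; apply: posI.
  rewrite neq_ltn => /orP[].
    exact: alternate_clique.
  by rewrite alternate_sym; apply: alternate_clique.
- by rewrite alternate_cross ?crossE ?in_setC //; apply: gP.
- by rewrite Esym alternate_sym alternate_cross ?crossE ?in_setC //; apply: gP.
rewrite (negPf (indC a b _ _)) ?in_setC //; apply/esym/negbTE.
have [lab|] := eqVneq (lin a) (lin b); first exact: non_alternate_same.
case la: (lin a); case lb: (lin b) => // _.
  by apply: non_alternate_mixed; rewrite ?la ?lb ?mixE ?in_setC ?la ?lb.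
rewrite alternate_sym.
by apply: non_alternate_mixed; rewrite ?la ?lb ?mixE ?in_setC ?la ?lb.
Qed.
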